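(* Uniformly in the parameter $c\in \mathrm{CompStr}$, the set $\mathrm{ACL}_0^c$ is a $\Sigma^0_2$ set.
   Context: Languages are relational and may be many-sorted: $\mathcal{L} = ((X_j)_{j\in J}, (R_i)_{i\in I})$ with sorts $X_j$ and relation symbols $R_i$, where $I,J\in\mathbb{N}\cup\{\mathbb{N}\}$ (a natural number is identified with the set of its predecessors). The type of a tuple of elements or variables is the product of the sorts of its entries, in order; the type of a relation symbol is a finite product of sorts. $\mathcal{L}$ is computable when the function sending $i\in I$ to $(j_0,\dots,j_{m-1})$, where $R_i$ has type $\prod_{k<m}X_{j_k}$, is computable; for each computable language a computable encoding of its first-order formulas is fixed. A computable $\mathcal{L}$-structure $\mathcal{N}$ has a computable underlying set, and $\{(a,j) : a\in (X_j)^{\mathcal{N}}\}$ and $\{(\overline{b},i) : \overline{b}\in (R_i)^{\mathcal{N}}\}$ are computable. Writing $\{e\}$ for the $e$th Turing machine, $c\in\mathbb{N}$ is a code for a structure if $\{c\}(0)$ is a code for a computable language, denoted $\mathcal{L}_c$, and $\{c\}(1)$ is a code for a computable $\mathcal{L}_c$-structure, denoted $\mathcal{M}_c$. $\mathrm{CompStr}$ is the set of all codes for structures. $\mathrm{ACL}^c_0$ is the set of pairs $(\varphi(\overline{x};\overline{y}),\overline{a})$ such that $\varphi$ is a quantifier-free first-order $\mathcal{L}_c$-formula with a specified partition $\overline{x};\overline{y}$ of its free variables, $\overline{a}\in\mathcal{M}_c$ has the same type as $\overline{x}$, and $\{\overline{b}\in\mathcal{M}_c : \mathcal{M}_c\models\varphi(\overline{a};\overline{b})\}$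 is finite (possibly empty). ''Uniformly in $c$'' means that a $\Sigma^0_2$ description of the set is obtained computably from $c$. *)

(* Defs.v *)
From mathcomp Require Import all_boot.
From mathcomp Require Import boolp classical_sets cardinality.
From Stdlib Require Cantor.

Set Implicit Arguments.
Unset Strict Implicit.
Unset Printing Implicit Defensive.

Local Open Scope classical_set_scope.

(** * Partial computable functions *)

Definition cpair (a b : nat) : nat := Cantor.to_nat (a, b).
Definition cunpair (n : nat) : nat * nat := Cantor.of_nat n.

(* Programs for the unary partial recursive functions, numbered below to give
   {e}; several arguments are passed as one
   number through the bijection [cpair]. *)
Inductive prog : Type :=
| PZero
| PSucc
| PLeft
| PRight
| PPair (p q : prog)
| PComp (p q : prog)
| PRec (p q : prog)
| PMu (p : prog).

(* h(a, 0) = F(a) and h(a, n + 1) = G(a, (n, h(a, n))) *)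
Fixpoint rec_graph (F G : nat -> nat -> Prop) (a n y : nat) : Prop :=
  if n is n'.+1
  then exists2 z, rec_graph F G a n' z & G (cpair a (cpair n' z)) y
  else F a y.

(* y is least with F(a, y) = 0, all the previous values being defined *)
Definition mu_graph (F : nat -> nat -> Prop) (a y : nat) : Prop :=
  F (cpair a y) 0 /\ forall k, k < y -> exists z, F (cpair a k) z.+1.

(* [eval p x y]: the program p halts on input x with output y. *)
Fixpoint eval (p : prog) (x y : nat) : Prop :=
  match p with
  | PZero => y = 0
  | PSucc => y = x.+1
  | PLeft => y = (cunpair x).1
  | PRight => y = (cunpair x).2
  | PPair p q => exists u v, [/\ eval p x u, eval q x v & y = cpair u v]
  | PComp p q => exists2 z, eval q x z & eval p z y
  | PRec p q => rec_graph (eval p) (eval q) (cunpair x).1 (cunpair x).2 y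
  | PMu p => mu_graph (eval p) x y
  end.

Fixpoint code_prog (p : prog) : nat :=
  match p with
  | PZero => cpair 0 0
  | PSucc => cpair 1 0
  | PLeft => cpair 2 0
  | PRight => cpair 3 0
  | PPair p q => cpair 4 (cpair (code_prog p) (code_prog q))
  | PComp p q => cpair 5 (cpair (code_prog p) (code_prog q))
  | PRec p q => cpair 6 (cpair (code_prog p) (code_prog q))
  | PMu p => cpair 7 (code_prog p)
  end.

(* [run e x y] is {e}(x) = y; a number that codes no program indexes the
   nowhere defined function. *)
Definition run (e x y : nat) : Prop := exists2 p, code_prog p = e & eval p x y.

(* [decides e A]: {e} is total and is the characteristic function of A. *)
Definition decides (e : nat) (A : set nat) : Prop :=
  forall n, (A n /\ run e n 1) \/ (~ A n /\ run e n 0).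

(* e is an index of a computable ternary relation R such that
   x \in A <-> exists n, forall m, R x n m. *)
Definition Sigma02_index (e : nat) (A : set nat) : Prop :=
  exists R : nat -> nat -> nat -> Prop,
    decides e [set k | exists x n m, k = cpair x (cpair n m) /\ R x n m] /\
    (forall x, A x <-> exists n, forall m, R x n m).

(** * Languages and structures *)

(* [Some n] stands for the index set {0, ..., n - 1}, [None] for all of nat. *)
Definition below (I : option nat) (i : nat) : bool :=
  if I is Some n then i < n else true.

(* The values of [rel_type] outside the index set of the relation symbols are
   irrelevant. *)
Record language : Type := Language {
  sorts : option nat;
  rels : option nat;
  rel_type : nat -> seq nat;
  rel_typeP : forall i, below rels i -> all (below sorts) (rel_type i)
}.

(* [has_type X a js]: the tuple a belongs to the product of the X_j, j in js. *)
Definition has_type (X : nat -> set nat) (a js : seq nat) : Prop :=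
  size a = size js /\
  forall k, k < size js -> X (nth 0 js k) (nth 0 a k).

(* Every element of the underlying set has exactly one sort. *)
Record structure (L : language) : Type := Structure {
  carrier : set nat;
  sort_in : nat -> set nat;
  rel_in : nat -> set (seq nat);
  sort_inP : forall j a, sort_in j a -> below (sorts L) j /\ carrier a;
  carrierP : forall a, carrier a -> exists! j, sort_in j a;
  rel_inP : forall i b, rel_in i b ->
    below (rels L) i /\ has_type sort_in b (rel_type L i)
}.

(** * Codes for structures *)

Fixpoint code_seq (s : seq nat) : nat :=
  if s is x :: s' then (cpair x (code_seq s')).+1 else 0.

Definition code_bound (I : option nat) : nat := if I is Some n then n.+1 else 0.

Definition codes_language (l : nat) (L : language) : Prop :=
  exists e,
    l = cpair (code_bound (sorts L)) (cpair (code_bound (rels L)) e) /\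
    (forall i, below (rels L) i -> run e i (code_seq (rel_type L i))).

Definition codes_structure (d : nat) (L : language) (M : structure L) : Prop :=
  exists e0 e1 e2,
    [/\ d = cpair e0 (cpair e1 e2),
        decides e0 (carrier M),
        decides e1 [set n | exists a j, n = cpair a j /\ sort_in M j a]
      & decides e2 [set n | exists b i,
                              n = cpair (code_seq b) i /\ rel_in M i b]].

(* An element of CompStr is a number c bundled with the language L_c and the
   structure M_c that it codes. *)
Record CompStr : Type := MkCompStr {
  cs_code :> nat;
  cs_lang : language;
  cs_str : structure cs_lang;
  cs_langP : exists2 l, run cs_code 0 l & codes_language l cs_lang;
  cs_strP : exists2 d, run cs_code 1 d & codes_structure d cs_str
}.

(** * First-order formulas *)

(* (j, n) is the n-th variable of sort X_j. *)
Definition var : Type := (nat * nat)%type.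

Inductive formula : Type :=
| FBot
| FEq (x y : var)
| FRel (i : nat) (xs : seq var)
| FNot (f : formula)
| FAnd (f g : formula)
| FOr (f g : formula)
| FImp (f g : formula)
| FAll (x : var) (f : formula)
| FEx (x : var) (f : formula).

Definition var_type (xs : seq var) : seq nat := [seq x.1 | x <- xs].

(* f is an L-formula. *)
Fixpoint wf (L : language) (f : formula) : bool :=
  match f with
  | FBot => true
  | FEq x y => below (sorts L) x.1 && (x.1 == y.1)
  | FRel i xs => below (rels L) i && (var_type xs == rel_type L i)
  | FNot f => wf L f
  | FAnd f g | FOr f g | FImp f g => wf L f && wf L g
  | FAll x f | FEx x f => below (sorts L) x.1 && wf L f
  end.

Fixpoint qfree (f : formula) : bool :=
  match f with
  | FBot | FEq _ _ | FRel _ _ => true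
  | FNot f => qfree f
  | FAnd f g | FOr f g | FImp f g => qfree f && qfree g
  | FAll _ _ | FEx _ _ => false
  end.

Fixpoint free_vars (f : formula) : seq var :=
  match f with
  | FBot => [::]
  | FEq x y => [:: x; y]
  | FRel _ xs => xs
  | FNot f => free_vars f
  | FAnd f g | FOr f g | FImp f g => free_vars f ++ free_vars g
  | FAll x f | FEx x f => [seq y <- free_vars f | y != x]
  end.

Fixpoint sat (L : language) (M : structure L) (v : var -> nat) (f : formula) :
    Prop :=
  match f with
  | FBot => False
  | FEq x y => v x = v y
  | FRel i xs => rel_in M i [seq v x | x <- xs]
  | FNot f => ~ sat M v f
  | FAnd f g => sat M v f /\ sat M v g
  | FOr f g => sat M v f \/ sat M v g
  | FImp f g => sat M v f -> sat M v g
  | FAll x f => forall a, sort_in M x.1 a ->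
      sat M (fun y => if y == x then a else v y) f
  | FEx x f => exists2 a, sort_in M x.1 a &
      sat M (fun y => if y == x then a else v y) f
  end.

(* The assignment sending the k-th variable of xs to the k-th entry of a. *)
Definition assign (xs : seq var) (a : seq nat) (x : var) : nat :=
  nth 0 a (index x xs).

(* phi(x; y): the variables of xs and ys are pairwise distinct and together are
   exactly the free variables of phi. *)
Record pformula : Type := PFormula {
  pf_form : formula;
  pf_x : seq var;
  pf_y : seq var
}.

Definition wf_pformula (L : language) (phi : pformula) : Prop :=
  [/\ wf L (pf_form phi),
      uniq (pf_x phi ++ pf_y phi)
    & free_vars (pf_form phi) =i pf_x phi ++ pf_y phi].

(* { b : M |= phi(a; b) } *)
Definition solutions (L : language) (M : structure L) (phi : pformula)
    (a : seq nat) : set (seq nat) :=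
  [set b | has_type (sort_in M) b (var_type (pf_y phi)) /\
           sat M (assign (pf_x phi ++ pf_y phi) (a ++ b)) (pf_form phi)].

Definition ACL0 (c : CompStr) : set (pformula * seq nat) :=
  [set p | [/\ wf_pformula (cs_lang c) p.1,
               qfree (pf_form p.1),
               has_type (sort_in (cs_str c)) p.2 (var_type (pf_x p.1))
             & finite_set (solutions (cs_str c) p.1 p.2)]].

(** * Encoding of formulas *)

Definition code_var (x : var) : nat := cpair x.1 x.2.
Definition code_vars (xs : seq var) : nat := code_seq [seq code_var x | x <- xs].

Fixpoint code_formula (f : formula) : nat :=
  match f with
  | FBot => cpair 0 0
  | FEq x y => cpair 1 (cpair (code_var x) (code_var y))
  | FRel i xs => cpair 2 (cpair i (code_vars xs))
  | FNot f => cpair 3 (code_formula f)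
  | FAnd f g => cpair 4 (cpair (code_formula f) (code_formula g))
  | FOr f g => cpair 5 (cpair (code_formula f) (code_formula g))
  | FImp f g => cpair 6 (cpair (code_formula f) (code_formula g))
  | FAll x f => cpair 7 (cpair (code_var x) (code_formula f))
  | FEx x f => cpair 8 (cpair (code_var x) (code_formula f))
  end.

Definition code_pformula (phi : pformula) : nat :=
  cpair (code_formula (pf_form phi))
        (cpair (code_vars (pf_x phi)) (code_vars (pf_y phi))).

Definition code_instance (p : pformula * seq nat) : nat :=
  cpair (code_pformula p.1) (code_seq p.2).

Lemma cpair_inj a b a' b' : cpair a b = cpair a' b' -> a = a' /\ b = b'.
Proof. by move/(can_inj Cantor.cancel_of_to) => -[-> ->]. Qed.

Lemma code_seq_inj : injective code_seq.
Proof.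
elim=> [|x s IH] [|y t] //= [] /cpair_inj[-> /IH ->] //.
Qed.

Lemma code_prog_inj : injective code_prog.
Proof.
elim=> [||||p IHp q IHq|p IHp q IHq|p IHp q IHq|p IHp]
  [||||p' q'|p' q'|p' q'|p'] //= /cpair_inj[] //.
- by move=> _ /cpair_inj[/IHp -> /IHq ->].
- by move=> _ /cpair_inj[/IHp -> /IHq ->].
- by move=> _ /cpair_inj[/IHp -> /IHq ->].
- by move=> _ /IHp ->.
Qed.

Lemma code_var_inj : injective code_var.
Proof. by move=> [i n] [j m] /cpair_inj /= [-> ->]. Qed.

Lemma code_vars_inj : injective code_vars.
Proof. by move=> xs ys /code_seq_inj /(inj_map code_var_inj). Qed.

Lemma code_formula_inj : injective code_formula.
Proof.
elim=> [|x y|i xs|f IHf|f IHf g IHg|f IHf g IHg|f IHf g IHg|x f IHf|x f IHf]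
  [|x' y'|i' xs'|f'|f' g'|f' g'|f' g'|x' f'|x' f'] //= /cpair_inj[] //.
- by move=> _ /cpair_inj[/code_var_inj -> /code_var_inj ->].
- by move=> _ /cpair_inj[-> /code_vars_inj ->].
- by move=> _ /IHf ->.
- by move=> _ /cpair_inj[/IHf -> /IHg ->].
- by move=> _ /cpair_inj[/IHf -> /IHg ->].
- by move=> _ /cpair_inj[/IHf -> /IHg ->].
- by move=> _ /cpair_inj[/code_var_inj -> /IHf ->].
- by move=> _ /cpair_inj[/code_var_inj -> /IHf ->].
Qed.

Lemma code_instance_inj : injective code_instance.
Proof.
move=> [[f x y] a] [[f' x' y'] a'] /cpair_inj[/cpair_inj[/code_formula_inj /= ->]].
by move=> /cpair_inj[/code_vars_inj -> /code_vars_inj ->] /code_seq_inj /= ->.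
Qed.

(* Main.v *)
Require Import Defs.
From mathcomp Require Import all_boot.
From mathcomp Require Import boolp classical_sets cardinality.
From Stdlib Require Cantor.

Set Implicit Arguments.
Unset Strict Implicit.
Unset Printing Implicit Defensive.

Local Open Scope classical_set_scope.

(** Fix c.  An instance (phi(x; y), a) lies in ACL_0^c exactly when its code is
    that of a well-formed instance and its solutions b have bounded codes: some
    N satisfies, for all b, [b is a solution -> code of b <= N].  Since phi is
    quantifier-free, being a solution is decidable, so the matrix of this
    statement is a computable relation of the instance, N and b, and the
    description is Sigma^0_2.

    Uniformity in c requires running machines whose indices are themselves
    computed from c, so a universal program is needed.  Programs are interpreted
    by a small machine with a stack of pending computations, whose step function
    is computable; [comp_run] searches for a halting time of this machine.  With
    it, the sorts, the relation types, the membership tests of sorts and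
    relations become computable functions of c ([comp_sort_in], [comp_rel_in]).

    Everything is phrased with [computable f], for f : T -> U between types with
    a numerical coding: some program sends the code of each t to the code of
    f t.  Nothing is asked of numbers that code no t.  As [CompStr] may be a
    factor of T, the promise that c is a code for a structure is carried by the
    type T, and the partiality of the programs involved never surfaces.

    Formulas are not parsed from their codes.  The existential quantifier that
    guesses N also guesses a postfix notation of phi, which is checked against
    the given code; then well-formedness, free variables and truth are computed
    by a stack evaluation of that notation ([comp_postfix], [postfix_map]).
    The resulting computable relation is [witnesses], and [ACL0_witnesses] is
    the Sigma^0_2 description.  Finally the program that decides [witnesses] for
    all c at once is specialized to c by an s-m-n argument
    ([comp_specialize]), which gives the index as a computable function of c.
    *)

(** * Computable functions between coded types *)

Arguments cpair : simpl never.
Arguments cunpair : simpl never.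

Lemma cpairK a b : cunpair (cpair a b) = (a, b).
Proof. exact: Cantor.cancel_of_to. Qed.

Lemma cunpairK n : cpair (cunpair n).1 (cunpair n).2 = n.
Proof. by rewrite /cpair -surjective_pairing; exact: Cantor.cancel_to_of. Qed.

Lemma leq_cpairr a b : b <= cpair a b.
Proof.
apply: (@leq_trans (b + a)); first exact: leq_addr.
exact/leP/Cantor.to_nat_non_decreasing.
Qed.

(** A coding is an arbitrary function, to accommodate [CompStr], whose coding
    forgets the language and the structure. *)
Class Coded (T : Type) := enc : T -> nat.

#[export] Instance coded_nat : Coded nat := id.
#[export] Instance coded_bool : Coded bool := nat_of_bool.
#[export] Instance coded_bound : Coded (option nat) := code_bound.
#[export] Instance coded_pair T U (cT : Coded T) (cU : Coded U) :
  Coded (T * U)%type := fun p => cpair (enc p.1) (enc p.2).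
#[export] Instance coded_seq T (cT : Coded T) : Coded (seq T) :=
  fix enc_seq s := if s is x :: s' then (cpair (enc x) (enc_seq s')).+1 else 0.
#[export] Instance coded_formula : Coded formula := code_formula.
#[export] Instance coded_CompStr : Coded CompStr := cs_code.

(** The program is constrained on the codes of elements of T only; a promise on
    the inputs is thus expressed by the choice of T. *)
Definition computable {T U} {cT : Coded T} {cU : Coded U} (f : T -> U) : Prop :=
  exists p, forall t, eval p (enc t) (enc (f t)).

Definition pid := PPair PLeft PRight.

Lemma eval_pid n : eval pid n n.
Proof. by exists (cunpair n).1, (cunpair n).2; rewrite cunpairK. Qed.

Fixpoint pconst (n : nat) : prog :=
  if n is n'.+1 then PComp PSucc (pconst n') else PZero.

Lemma eval_pconst n x : eval (pconst n) x n.
Proof. by elim: n => [|n IH] //=; exists n. Qed.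

Section Closure.
Context {T U V : Type} {cT : Coded T} {cU : Coded U} {cV : Coded V}.

Lemma comp_ext (f g : T -> U) : f =1 g -> computable f -> computable g.
Proof. by move=> fg [p fp]; exists p => t; rewrite -fg. Qed.

Lemma comp_id : computable (fun t : T => t).
Proof. by exists pid => t; exact: eval_pid. Qed.

Lemma comp_const (v : U) : computable (fun _ : T => v).
Proof. by exists (pconst (enc v)) => t; exact: eval_pconst. Qed.

Lemma comp_app (g : U -> V) (f : T -> U) :
  computable g -> computable f -> computable (fun t => g (f t)).
Proof. by move=> [q gq] [p fp]; exists (PComp q p) => t; exists (enc (f t)). Qed.

Lemma comp_pair (f : T -> U) (g : T -> V) :
  computable f -> computable g -> computable (fun t => (f t, g t)).
Proof.
move=> [p fp] [q gq]; exists (PPair p q) => t.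
by exists (enc (f t)), (enc (g t)).
Qed.

Lemma comp_fst (f : T -> U * V) : computable f -> computable (fun t => (f t).1).
Proof.
move=> [p fp]; exists (PComp PLeft p) => t; exists (enc (f t)) => //=.
by rewrite cpairK.
Qed.

Lemma comp_snd (f : T -> U * V) : computable f -> computable (fun t => (f t).2).
Proof.
move=> [p fp]; exists (PComp PRight p) => t; exists (enc (f t)) => //=.
by rewrite cpairK.
Qed.

Lemma comp_iteri (n : T -> nat) (g : T -> nat -> U -> U) (z : T -> U) :
    computable n -> computable (fun p : T * (nat * U) => g p.1 p.2.1 p.2.2) ->
  computable z -> computable (fun t => iteri (n t) (g t) (z t)).
Proof.
move=> [pn nP] [pg gP] [pz zP]; exists (PComp (PRec pz pg) (PPair pid pn)) => t.
exists (cpair (enc t) (n t)).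
  by exists (enc t), (n t); split; [exact: eval_pid | exact: nP | ].
rewrite /= cpairK /=; elim: (n t) => [|k IH] //=.
by exists (enc (iteri k (g t) (z t))) => //; exact: (gP (t, (k, _))).
Qed.

End Closure.

Section Composition.
Context {T U V W X : Type} {cT : Coded T} {cU : Coded U} {cV : Coded V}
  {cW : Coded W} {cX : Coded X}.

(** Parameters in the results below range over a context type T, and functions
    of several arguments are uncurried into nested pairs. *)
Lemma comp2 (g : U -> V -> W) (a : T -> U) (b : T -> V) :
    computable (fun p : U * V => g p.1 p.2) ->
  computable a -> computable b -> computable (fun t => g (a t) (b t)).
Proof. by move=> cg ca cb; exact: (comp_app cg (comp_pair ca cb)). Qed.

Lemma comp3 (g : U -> V -> W -> X) (a : T -> U) (b : T -> V) (c : T -> W) :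
    computable (fun p : U * (V * W) => g p.1 p.2.1 p.2.2) ->
    computable a -> computable b -> computable c ->
  computable (fun t => g (a t) (b t) (c t)).
Proof.
by move=> cg ca cb cc; exact: (comp_app cg (comp_pair ca (comp_pair cb cc))).
Qed.

End Composition.

(** [comp] decomposes a computability goal along the syntax of the function;
    [comp_hint] is extended whenever new operations are shown computable. *)
Ltac comp_hint := fail.

Ltac comp_step :=
  first
  [ assumption
  | match goal with
    | |- computable (fun _ => ?v) => exact (comp_const v)
    | |- computable (fun t => t) => exact comp_id
    | |- computable (fun t => (_, _)) => apply comp_pair
    | |- computable (fun t => fst _) => apply comp_fst
    | |- computable (fun t => snd _) => apply comp_snd
    | |- computable fst => exact (comp_fst comp_id)
    | |- computable snd => exact (comp_snd comp_id)
    | H : computable (fun p => ?g p.1 p.2.1 p.2.2)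
      |- computable (fun t => ?g _ _ _) => refine (comp3 H _ _ _)
    | H : computable (fun p => ?g p.1 p.2) |- computable (fun t => ?g _ _) =>
        refine (comp2 H _ _)
    | H : computable ?g |- computable (fun t => ?g _) => refine (comp_app H _)
    end
  | comp_hint ].
Ltac comp := repeat (comp_step; cbv beta).

Section Arithmetic.
Context {T : Type} {cT : Coded T}.

Lemma comp_enc U (cU : Coded U) (f : T -> U) :
  computable f -> computable (fun t => enc (f t)).
Proof. by []. Qed.

Lemma comp_succ (n : T -> nat) : computable n -> computable (fun t => (n t).+1).
Proof.
by move=> [p nP]; exists (PComp PSucc p) => t; exists (n t) => //; exact: nP.
Qed.

Lemma comp_cpair (m n : T -> nat) :
  computable m -> computable n -> computable (fun t => cpair (m t) (n t)).
Proof. by move=> cm cn; exact: (comp_pair cm cn). Qed.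

Lemma comp_cunpair (n : T -> nat) :
  computable n -> computable (fun t => cunpair (n t)).
Proof.
by move=> [p nP]; exists p => t; rewrite /enc /coded_pair cunpairK; exact: nP.
Qed.

Lemma comp_pred (n : T -> nat) : computable n -> computable (fun t => (n t).-1).
Proof.
move=> cn; apply: (@comp_ext _ _ _ _ (fun t => iteri (n t) (fun k _ => k) 0)).
  by move=> t; case: (n t).
by apply: (comp_iteri (g := fun _ k _ => k)); comp.
Qed.

End Arithmetic.

Section Comparison.
Context {T : Type} {cT : Coded T}.

Lemma comp_sub (m n : T -> nat) :
  computable m -> computable n -> computable (fun t => m t - n t).
Proof.
move=> cm cn.
apply: (@comp_ext _ _ _ _ (fun t => iteri (n t) (fun _ => predn) (m t))).
  by move=> t; elim: (n t) => [|k IH]; rewrite ?subn0 //= IH subnS.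
by apply: (comp_iteri (g := fun _ _ => predn)); comp; apply: comp_pred; comp.
Qed.

Lemma comp_if U {cU : Coded U} (b : T -> bool) (f g : T -> U) :
    computable b -> computable f -> computable g ->
  computable (fun t => if b t then f t else g t).
Proof.
move=> cb cf cg.
apply: (@comp_ext _ _ _ _ (fun t => iteri (b t) (fun _ _ => f t) (g t))).
  by move=> t; case: (b t).
by apply: (comp_iteri (g := fun t _ _ => f t)); comp.
Qed.

Lemma comp_neg (a : T -> bool) : computable a -> computable (fun t => ~~ a t).
Proof. by move=> ca; apply: (comp_if ca); comp. Qed.

Lemma comp_and (a b : T -> bool) :
  computable a -> computable b -> computable (fun t => a t && b t).
Proof. by move=> ca cb; apply: (comp_if ca); comp. Qed.

Lemma comp_or (a b : T -> bool) :
  computable a -> computable b -> computable (fun t => a t || b t).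
Proof. by move=> ca cb; apply: (comp_if ca); comp. Qed.

Lemma comp_imp (a b : T -> bool) :
  computable a -> computable b -> computable (fun t => a t ==> b t).
Proof. by move=> ca cb; apply: (comp_if ca); comp. Qed.

Lemma comp_leq (m n : T -> nat) :
  computable m -> computable n -> computable (fun t => m t <= n t).
Proof.
move=> cm cn; have cd := comp_sub cm cn.
apply: (@comp_ext _ _ _ _ (fun t => iteri (m t - n t) (fun _ _ => false) true)).
  by move=> t; rewrite /leq; case: (m t - n t).
by apply: (comp_iteri (g := fun _ _ _ => false)); comp.
Qed.

Lemma comp_eqn (m n : T -> nat) :
  computable m -> computable n -> computable (fun t => m t == n t).
Proof.
move=> cm cn; apply: (comp_ext (fun t => esym (eqn_leq (m t) (n t)))).
by apply: comp_and; apply: comp_leq.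
Qed.

Lemma comp_eq (U : eqType) (cU : Coded U) (a b : T -> U) :
    injective (enc : U -> nat) ->
  computable a -> computable b -> computable (fun t => a t == b t).
Proof.
move=> encI ca cb; apply: (comp_ext (fun t => inj_eq encI (a t) (b t))).
by apply: comp_eqn; exact: comp_enc.
Qed.

End Comparison.

Section Search.
Context {T : Type} {cT : Coded T}.

(** Unbounded search: the program [PMu] finds the least n with [P t n]. *)
Lemma comp_search (P : T -> nat -> bool) :
    computable (fun p : T * nat => P p.1 p.2) -> (forall t, exists n, P t n) ->
  exists2 mu : T -> nat, computable mu & forall t, P t (mu t).
Proof.
move=> /comp_neg[p pP] exP; exists (fun t => ex_minn (exP t)); last first.
  by move=> t; case: ex_minnP.
exists (PMu p) => t; case: ex_minnP => n Pn minn; split.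
  by have := pP (t, n); rewrite /= Pn.
move=> k ltkn; exists 0; have := pP (t, k); rewrite /=.
by case E: (P t k) => //; move/minn: E; rewrite leqNgt ltkn.
Qed.

End Search.

Ltac comp_arith :=
  match goal with
  | |- computable (fun t => S _) => apply comp_succ
  | |- computable (fun t => predn _) => apply comp_pred
  | |- computable (fun t => subn _ _) => apply comp_sub
  | |- computable (fun t => leq _ _) => apply comp_leq
  | |- computable (fun t => eq_op _ _) => apply comp_eqn
  | |- computable (fun t => negb _) => apply comp_neg
  | |- computable (fun t => andb _ _) => apply comp_and
  | |- computable (fun t => orb _ _) => apply comp_or
  | |- computable (fun t => implb _ _) => apply comp_imp
  | |- computable (fun t => if _ then _ else _) => apply comp_if
  | |- computable (fun t => cpair _ _) => apply comp_cpair
  | |- computable (fun t => cunpair _) => apply comp_cunpair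
  | |- computable (fun t => enc _) => apply comp_enc
  | |- computable (fun t => nat_of_bool ?b) => apply (@comp_enc _ _ bool)
  end.
Ltac comp_hint ::= comp_arith.

Section SeqCases.
Context {T U V : Type} {cT : Coded T} {cU : Coded U} {cV : Coded V}.

Lemma comp_cons (x : T -> U) (s : T -> seq U) :
  computable x -> computable s -> computable (fun t => x t :: s t).
Proof.
move=> cx cs.
apply: (comp_succ (n := fun t => cpair (enc (x t)) (enc (s t)))).
by apply: comp_cpair.
Qed.

(** The cons branch must be evaluated lazily: for an empty list the head and
    tail read off the code need not code anything, and the program for g may
    diverge on them.  Primitive recursion over 0 or 1 runs its step function
    only in the cons case. *)
Lemma comp_case_seq (s : T -> seq U) (z : T -> V) (g : T -> U -> seq U -> V) :
    computable s -> computable z ->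
    computable (fun p : T * (U * seq U) => g p.1 p.2.1 p.2.2) ->
  computable (fun t => if s t is x :: s' then g t x s' else z t).
Proof.
move=> cs [pz zP] [pg gP].
(* the context, the raw head and tail of s, and 1 or 0 as s is a cons or nil *)
have [pa aP] : computable (fun t =>
    ((t, cunpair (enc (s t)).-1), (0 < enc (s t) : nat))).
  by comp.
exists (PComp (PRec (PComp pz PLeft) (PComp pg PLeft)) pa) => t.
exists (enc (t, cunpair (enc (s t)).-1, (0 < enc (s t) : nat))) => //=.
have := zP t; have := fun x s' => gP (t, (x, s')).
rewrite /= cpairK /=; case: (s t) => [|x s'] /= gP' zP'.
  by exists (enc t); rewrite ?[cunpair _]cpairK.
exists (enc (z t)).
  by exists (enc t); rewrite ?[cunpair _]cpairK.
exists (enc (t, (x, s'))); last exact: gP'.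
by rewrite !cpairK.
Qed.

End SeqCases.

Ltac comp_cons_step :=
  match goal with
  | |- computable (fun t => cons _ _) => apply comp_cons
  end.
Ltac comp_hint ::= first [comp_arith | comp_cons_step].

Section LeftFolds.
Context {T U V : Type} {cT : Coded T} {cU : Coded U} {cV : Coded V}.

(** Consume the list one element per iteration.  The code of a list is at least
    its length, hence a sufficient number of iterations. *)
Lemma comp_foldl (g : T -> V -> U -> V) (z : T -> V) (s : T -> seq U) :
    computable (fun p : T * (V * U) => g p.1 p.2.1 p.2.2) ->
    computable z -> computable s ->
  computable (fun t => foldl (g t) (z t) (s t)).
Proof.
move=> cg cz cs.
pose step t (_ : nat) (p : seq U * V) :=
  if p.1 is x :: s' then (s', g t p.2 x) else p.
apply: (@comp_ext _ _ _ _ (fun t => (iteri (enc (s t)) (step t) (s t, z t)).2)).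
  move=> t; set n := enc (s t); have : size (s t) <= n.
    rewrite /n; elim: (s t) => //= x s' IH; rewrite ltnS.
    exact: leq_trans IH (leq_cpairr _ _).
  suff iterE m acc s' : size s' <= m ->
      iteri m (step t) (s', acc) = ([::], foldl (g t) acc s').
    by move/iterE ->.
  have iteriSr k p : iteri k.+1 (step t) p = iteri k (step t) (step t 0 p).
    by elim: k => //= k <-.
  elim: m acc s' => [|m IH] acc [|x s'] // les; rewrite iteriSr IH //.
apply: comp_snd; apply: comp_iteri; comp.
apply: (comp_case_seq (s := fun p => p.2.2.1) (z := fun p => p.2.2)
  (g := fun p x s' => (s', g p.1 p.2.2.2 x))); comp.
Qed.

End LeftFolds.

Section Reversal.
Context {T U : Type} {cT : Coded T} {cU : Coded U}.

Lemma comp_rev (s : T -> seq U) : computable s -> computable (fun t => rev (s t)).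
Proof.
move=> cs; apply: (@comp_ext _ _ _ _
    (fun t => foldl (fun acc x => x :: acc) [::] (s t))).
  move=> t; rewrite /rev; elim: (s t) [::] => //=.
by apply: (comp_foldl (g := fun _ acc x => x :: acc)); comp.
Qed.

End Reversal.

Section RightFolds.
Context {T U V : Type} {cT : Coded T} {cU : Coded U} {cV : Coded V}.

Lemma comp_foldr (g : T -> U -> V -> V) (z : T -> V) (s : T -> seq U) :
    computable (fun p : T * (U * V) => g p.1 p.2.1 p.2.2) ->
    computable z -> computable s ->
  computable (fun t => foldr (g t) (z t) (s t)).
Proof.
move=> cg cz cs.
apply: (comp_ext (fun t => foldl_rev (fun v u => g t u v) (z t) (s t))).
apply: (comp_foldl (g := fun t v u => g t u v)); comp.
by apply: comp_rev.
Qed.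

End RightFolds.

Section SeqOperations.
Context {T U V : Type} {cT : Coded T} {cU : Coded U} {cV : Coded V}.

Lemma comp_cat (s1 s2 : T -> seq U) :
  computable s1 -> computable s2 -> computable (fun t => s1 t ++ s2 t).
Proof.
move=> c1 c2; apply: (comp_ext (f := fun t => foldr cons (s2 t) (s1 t))) => [t|].
  by elim: (s1 t) => //= x s ->.
by apply: (comp_foldr (g := fun=> cons)); comp.
Qed.

Lemma comp_size (s : T -> seq U) : computable s -> computable (fun t => size (s t)).
Proof.
move=> cs; apply: (comp_ext (f := fun t => foldr (fun _ => S) 0 (s t))) => [t|].
  by elim: (s t) => //= _ s' ->.
by apply: (comp_foldr (g := fun _ _ => S)); comp.
Qed.

Lemma comp_all (a : T -> pred U) (s : T -> seq U) :
    computable (fun p : T * U => a p.1 p.2) -> computable s ->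
  computable (fun t => all (a t) (s t)).
Proof.
move=> ca cs.
apply: (comp_ext (f := fun t => foldr (fun x b => a t x && b) true (s t))) => //.
by apply: (comp_foldr (g := fun t x b => a t x && b)); comp.
Qed.

Lemma comp_nth x0 (s : T -> seq U) (n : T -> nat) :
  computable s -> computable n -> computable (fun t => nth x0 (s t) (n t)).
Proof.
move=> cs cn.
apply: (comp_ext (f := fun t =>
    if iteri (n t) (fun=> behead) (s t) is x :: _ then x else x0)) => [t|].
  have -> : iteri (n t) (fun=> behead) (s t) = drop (n t) (s t).
    elim: (n t) => [|k /= ->]; first by rewrite drop0.
    by rewrite -drop1 drop_drop.
  by rewrite -[in RHS](addn0 (n t)) -nth_drop; case: drop.
apply: (comp_case_seq (s := fun t => iteri (n t) (fun=> behead) (s t))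
  (z := fun=> x0) (g := fun _ x _ => x)); comp.
apply: (comp_iteri (g := fun _ _ => behead)); comp.
apply: (comp_case_seq (s := fun p => p.2.2) (z := fun=> [::])
  (g := fun _ _ s' => s')); comp.
Qed.

Lemma comp_map (f : T -> U -> V) (s : T -> seq U) :
    computable (fun p : T * U => f p.1 p.2) -> computable s ->
  computable (fun t => map (f t) (s t)).
Proof.
move=> cf cs.
apply: (comp_ext (f := fun t => foldr (fun x r => f t x :: r) [::] (s t))) => //.
by apply: (comp_foldr (g := fun t x r => f t x :: r)); comp.
Qed.

Lemma comp_all_iota (a : T -> pred nat) (n : T -> nat) :
    computable (fun p : T * nat => a p.1 p.2) -> computable n ->
  computable (fun t => all (a t) (iota 0 (n t))).
Proof.
move=> ca cn.
apply: (comp_ext (f := fun t => iteri (n t) (fun k b => a t k && b) true)) => [t|].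
  elim: (n t) => // k IH; rewrite -[in iota _ _]addn1 iotaD all_cat -IH /=.
  by rewrite andbT andbC.
by apply: (comp_iteri (g := fun t k b => a t k && b)); comp.
Qed.

End SeqOperations.

Section SeqLookup.
Context {T : Type} {U : eqType} {cT : Coded T} {cU : Coded U}.
Hypothesis encI : injective (enc : U -> nat).

Lemma comp_index (x : T -> U) (s : T -> seq U) :
  computable x -> computable s -> computable (fun t => index (x t) (s t)).
Proof.
move=> cx cs.
apply: (comp_ext (f := fun t =>
    foldr (fun y n => if y == x t then 0 else n.+1) 0 (s t))) => [t|].
  by elim: (s t) => //= y s' ->.
apply: (comp_foldr (g := fun t y n => if y == x t then 0 else n.+1)); comp.
by apply: comp_eq; comp.
Qed.

Lemma comp_mem (x : T -> U) (s : T -> seq U) :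
  computable x -> computable s -> computable (fun t => x t \in s t).
Proof.
move=> cx cs; apply: (comp_ext (f := fun t => index (x t) (s t) < size (s t))).
  by move=> t; rewrite index_mem.
by comp; [apply: comp_index | apply: comp_size].
Qed.

End SeqLookup.

Lemma comp_uniq T (U : eqType) (cT : Coded T) (cU : Coded U) (s : T -> seq U) :
  injective (enc : U -> nat) -> computable s -> computable (fun t => uniq (s t)).
Proof.
move=> encI cs.
pose f (x : U) (p : seq U * bool) := (x :: p.1, (x \notin p.1) && p.2).
apply: (comp_ext (f := fun t => (foldr f ([::], true) (s t)).2)) => [t|].
  suff -> : foldr f ([::], true) (s t) = (s t, uniq (s t)) by [].
  by elim: (s t) => //= x s' ->.
comp; apply: (comp_foldr (g := fun=> f)); rewrite /f; comp.
by apply: comp_mem; comp.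
Qed.

Ltac comp_seq :=
  match goal with
  | |- computable (fun t => cat _ _) => apply comp_cat
  | |- computable (fun t => cons _ _) => apply comp_cons
  | |- computable (fun t => size _) => apply comp_size
  | |- computable (fun t => nth _ _ _) => apply comp_nth
  | |- computable (fun t => map _ _) => apply comp_map
  | |- computable (fun t => all _ (iota 0 _)) => apply comp_all_iota
  | |- computable (fun t => all _ _) => apply comp_all
  end.
Ltac comp_hint ::= first [comp_arith | comp_seq].

(** * A universal program *)

Definition frame : Type := (nat * (nat * (nat * nat)))%type.

(** A state (m, (v, K)) either evaluates the program number m - 1 on v, or, for
    m = 0, returns the value v to the stack K of pending computations. *)
Definition state : Type := (nat * (nat * seq frame))%type.

Definition Eval e x K : state := (e.+1, (x, K)).
Definition Ret y K : state := (0, (y, K)).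

Definition Frame tag a b c : frame := (tag, (a, (b, c))).

(** The frames are, by tag: 0, the second half of a pair is still to be
    evaluated; 1, its first half is known; 2, the outer program of a composition
    awaits its argument; 3, a recursion step awaits the previous value; 4, a
    search awaits the value at the candidate c. *)
Definition resume v (fr : frame) K : state :=
  let tag := fr.1 in let a := fr.2.1 in
  let b := fr.2.2.1 in let c := fr.2.2.2 in
  if tag == 0 then Eval a b (Frame 1 v 0 0 :: K)
  else if tag == 1 then Ret (cpair a v) K
  else if tag == 2 then Eval a v K
  else if tag == 3 then Eval a (cpair b (cpair c v)) K
  else if v == 0 then Ret c K
  else Eval a (cpair b c.+1) (Frame 4 a b c.+1 :: K).

Definition start e x K : state :=
  let tag := (cunpair e).1 in let r := (cunpair e).2 in
  let p := (cunpair r).1 in let q := (cunpair r).2 in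
  let a := (cunpair x).1 in let n := (cunpair x).2 in
  if tag == 0 then Ret 0 K
  else if tag == 1 then Ret x.+1 K
  else if tag == 2 then Ret a K
  else if tag == 3 then Ret n K
  else if tag == 4 then Eval p x (Frame 0 q x 0 :: K)
  else if tag == 5 then Eval q x (Frame 2 p 0 0 :: K)
  else if tag == 6 then
    if n == 0 then Eval p a K
    else Eval e (cpair a n.-1) (Frame 3 q a n.-1 :: K)
  else Eval r (cpair x 0) (Frame 4 r x 0 :: K).

Definition step (s : state) : state :=
  if s.1 == 0 then if s.2.2 is fr :: K then resume s.2.1 fr K else s
  else start s.1.-1 s.2.1 s.2.2.

Definition halted (s : state) : bool := (s.1 == 0) && (size s.2.2 == 0).

Lemma comp_step_function : computable step.
Proof.
rewrite /step /start /Eval /Ret /Frame; cbv zeta; comp.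
apply: (comp_case_seq (s := fun s : state => s.2.2) (z := id)
  (g := fun s fr K => resume s.2.1 fr K)); comp.
by rewrite /resume /Eval /Ret /Frame; cbv zeta; comp.
Qed.

Definition reach (s s' : state) : Prop := exists n, iter n step s = s'.

Lemma reach_refl s : reach s s.
Proof. by exists 0. Qed.

Lemma reach_trans s2 s1 s3 : reach s1 s2 -> reach s2 s3 -> reach s1 s3.
Proof. by move=> [m <-] [n <-]; exists (n + m); rewrite iterD. Qed.

Lemma reach_step s s' : reach (step s) s' -> reach s s'.
Proof. by move=> [n <-]; exists n.+1; rewrite iterSr. Qed.

(** The machine simulates [eval], by induction on the program.  Only this
    direction matters, as the machine is deterministic: whenever the result
    is known to exist, any halting run must produce it. *)
Lemma reach_eval p x y K : eval p x y -> reach (Eval (code_prog p) x K) (Ret y K).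
Proof.
elim: p x y K => [||||p IHp q IHq|p IHp q IHq|p IHp q IHq|p IHp] x y K /=.
- by move=> ->; exists 1; rewrite /= /step /= /start !cpairK.
- by move=> ->; exists 1; rewrite /= /step /= /start !cpairK.
- by move=> ->; exists 1; rewrite /= /step /= /start !cpairK.
- by move=> ->; exists 1; rewrite /= /step /= /start !cpairK.
- move=> [u [v [pu qv ->]]]; apply: reach_step; rewrite /step /= /start !cpairK /=.
  apply: reach_trans (IHp _ _ _ pu) _; apply: reach_step => /=.
  apply: reach_trans (IHq _ _ _ qv) _; apply: reach_step; exact: reach_refl.
- move=> [z qz pz]; apply: reach_step; rewrite /step /= /start !cpairK /=.
  by apply: reach_trans (IHq _ _ _ qz) _; apply: reach_step; exact: IHp.
- rewrite -{3}(cunpairK x); move: (cunpair x) => [a n] /=.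
  elim: n y K => [|n IH] y K /=.
    move=> pay; apply: reach_step; rewrite /step /= /start !cpairK /=.
    exact: IHp.
  move=> [z rz qy]; apply: reach_step; rewrite /step /= /start !cpairK /=.
  apply: reach_trans (IH _ _ rz) _; apply: reach_step => /=; exact: IHq.
- move=> [py0 pk]; apply: reach_step; rewrite /step /= /start !cpairK /=.
  (* j candidates remain below y; induction on j runs the search backwards *)
  suff from j : j <= y ->
      reach (Eval (code_prog p) (cpair x (y - j))
              (Frame 4 (code_prog p) x (y - j) :: K)) (Ret y K).
    by have := from y (leqnn y); rewrite subnn; case: cunpair.
  elim: j => [_|j IH ltjy].
    rewrite subn0; apply: reach_trans (IHp _ _ _ py0) _.
    by apply: reach_step; exact: reach_refl.
  have [|z pz] := pk (y - j.+1); first by rewrite -subn_gt0 subKn.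
  apply: reach_trans (IHp _ _ _ pz) _; apply: reach_step.
  by rewrite /step /resume /= subnSK //; apply: IH; exact: ltnW.
Qed.

Lemma iter_halted n s : halted s -> iter n step s = s.
Proof.
case: s => [[|m] [v [|fr K]]] //= _; elim: n => //= n IH; by rewrite IH.
Qed.

(** The universal program: a computed index is run on a computed argument.  As
    the result y exists, the search for a halting time succeeds; a halted state
    is a fixed point of [step], so any halting time yields that result. *)
Lemma comp_run T (cT : Coded T) (e x y : T -> nat) :
    (forall t, run (e t) (x t) (y t)) -> computable e -> computable x ->
  computable y.
Proof.
move=> runy ce cx.
have reachy t : exists n, iter n step (Eval (e t) (x t) [::]) = Ret (y t) [::].
  by have [p <- /reach_eval] := runy t; apply.
pose run_for t n := iteri n (fun=> step) (Eval (e t) (x t) [::]).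
have run_forE t n : run_for t n = iter n step (Eval (e t) (x t) [::]).
  by elim: n => //= n ->.
have crun : computable (fun p : T * nat => run_for p.1 p.2).
  rewrite /run_for; apply: (comp_iteri (g := fun _ _ => step)); rewrite /Eval; comp.
  by apply: (comp_app comp_step_function); comp.
have [||mu cmu haltmu] := @comp_search T _ (fun t n => halted (run_for t n)).
- by rewrite /halted; comp.
- by move=> t; have [n nP] := reachy t; exists n; rewrite run_forE nP.
apply: (@comp_ext _ _ _ _ (fun t => (run_for t (mu t)).2.1)); last by comp.
move=> t; have [n nP] := reachy t; have := haltmu t; rewrite run_forE => halt.
by rewrite -(iter_halted n halt) -iterD addnC iterD nP iter_halted.
Qed.

(** * Coded structures *)

(** [code_bound] of the two index sets and the index e of the relation types are
    the components of {c}(0). *)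
Lemma language_index : exists2 e : CompStr -> nat,
  [/\ computable (fun c : CompStr => sorts (cs_lang c)),
      computable (fun c : CompStr => rels (cs_lang c)) & computable e] &
  forall (c : CompStr) i, below (rels (cs_lang c)) i ->
    run (e c) i (code_seq (rel_type (cs_lang c) i)).
Proof.
have /choice[e eP] (c : CompStr) : exists e,
    run c 0 (cpair (code_bound (sorts (cs_lang c)))
                   (cpair (code_bound (rels (cs_lang c))) e)) /\
    forall i, below (rels (cs_lang c)) i ->
      run e i (code_seq (rel_type (cs_lang c) i)).
  by have [l runl [e [def_l eP]]] := cs_langP c; exists e; rewrite -def_l.
exists e; last by move=> c; have [] := eP c.
have cl : computable (fun c : CompStr =>
    (sorts (cs_lang c), (rels (cs_lang c), e c))).
  apply: (@comp_run _ _ (fun c : CompStr => cs_code c) (fun=> 0)); last by comp.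
    by move=> c; have [] := eP c.
  exact: (comp_id (T := CompStr)).
split; first exact: (comp_fst cl).
  exact: (comp_fst (comp_snd cl)).
exact: (comp_snd (comp_snd cl)).
Qed.

Lemma run_decides e A n : decides e A -> run e n (`[< A n >] : bool).
Proof.
by move=> /(_ n)[[An run1]|[NAn run0]]; [rewrite asboolT | rewrite asboolF].
Qed.

Lemma structure_indices :
  exists e : CompStr -> nat * nat, computable e /\ forall c : CompStr,
  decides (e c).1 [set n | exists a j, n = cpair a j /\ sort_in (cs_str c) j a] /\
  decides (e c).2
    [set n | exists b i, n = cpair (code_seq b) i /\ rel_in (cs_str c) i b].
Proof.
have /choice[e eP] (d : CompStr) : exists e : nat * (nat * nat),
  [/\ run d 1 (enc e),
  decides e.2.1 [set n | exists a j, n = cpair a j /\ sort_in (cs_str d) j a] &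
  decides e.2.2
    [set n | exists b i, n = cpair (code_seq b) i /\ rel_in (cs_str d) i b]].
  have [l runl [e0 [e1 [e2 [def_l e0P e1P e2P]]]]] := cs_strP d.
  by exists (e0, (e1, e2)); split=> //; rewrite -[enc _]def_l.
have ce : computable e.
  apply: (@comp_run _ _ (fun c : CompStr => cs_code c) (fun=> 1)); last by comp.
    by move=> d; have [] := eP d.
  exact: (comp_id (T := CompStr)).
exists (fun d => (e d).2); split; first by comp.
by move=> d; have [] := eP d.
Qed.

Section CompStrContext.
Context {T : Type} {cT : Coded T} (c : T -> CompStr).
Hypothesis cc : computable c.

Lemma comp_below (I : T -> option nat) (i : T -> nat) :
  computable I -> computable i -> computable (fun t => below (I t) (i t)).
Proof.
move=> cI ci; apply: (comp_ext (f := fun t =>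
  (enc (I t) == 0) || (i t < (enc (I t)).-1))); last by comp.
by move=> t; case: (I t).
Qed.

Lemma comp_below_sorts (i : T -> nat) :
  computable i -> computable (fun t => below (sorts (cs_lang (c t))) (i t)).
Proof.
move=> ci; have [e [cS _ _] _] := language_index.
by apply: comp_below => //; apply: (comp_app cS).
Qed.

Lemma comp_below_rels (i : T -> nat) :
  computable i -> computable (fun t => below (rels (cs_lang (c t))) (i t)).
Proof.
move=> ci; have [e [_ cS _] _] := language_index.
by apply: comp_below => //; apply: (comp_app cS).
Qed.

(** Outside the index set the index in c may diverge, so the number 0, which
    codes the total program [PZero], is run instead; 0 is the code of [::]. *)
Lemma comp_rel_type (i : T -> nat) : computable i ->
  computable (fun t => if below (rels (cs_lang (c t))) (i t)
                       then rel_type (cs_lang (c t)) (i t) else [::]).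
Proof.
move=> ci; have [e [_ cR ce] eP] := language_index.
pose b t := below (rels (cs_lang (c t))) (i t).
apply: (@comp_run _ _ (fun t => if b t then e (c t) else 0) i).
- move=> t; rewrite /b; case: ifP => [/eP //|_].
  by exists PZero.
- by comp; exact: comp_below_rels.
- by comp.
Qed.

Lemma comp_sort_in (j a : T -> nat) : computable j -> computable a ->
  computable (fun t => `[< sort_in (cs_str (c t)) (j t) (a t) >]).
Proof.
move=> cj ca; have [e [ce eP]] := structure_indices.
apply: (@comp_run _ _ (fun t => (e (c t)).1) (fun t => cpair (a t) (j t))); comp.
move=> t; have [/run_decides-/(_ (cpair (a t) (j t))) + _] := eP (c t).
congr (run _ _ (nat_of_bool _)); apply: asbool_equiv_eq; split=> [|aj].
  by move=> [a' [j' [/cpair_inj[-> ->]]]].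
by exists (a t), (j t).
Qed.

Lemma comp_rel_in (i : T -> nat) (b : T -> seq nat) : computable i -> computable b ->
  computable (fun t => `[< rel_in (cs_str (c t)) (i t) (b t) >]).
Proof.
move=> ci cb; have [e [ce eP]] := structure_indices.
apply: (@comp_run _ _ (fun t => (e (c t)).2)
  (fun t => cpair (enc (b t)) (i t))); comp.
move=> t; have [_ /run_decides-/(_ (cpair (code_seq (b t)) (i t)))] := eP (c t).
congr (run _ _ (nat_of_bool _)); apply: asbool_equiv_eq; split=> [|bi].
  by move=> [b' [i' [/cpair_inj[/code_seq_inj-> ->]]]].
by exists (b t), (i t).
Qed.

End CompStrContext.

Lemma comp_has_type T (cT : Coded T) (c : T -> CompStr) (a js : T -> seq nat) :
    computable c -> computable a -> computable js ->
  computable (fun t => `[< has_type (sort_in (cs_str (c t))) (a t) (js t) >]).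
Proof.
move=> cc ca cj; apply: (comp_ext (f := fun t => (size (a t) == size (js t)) &&
  all (fun k => `[< sort_in (cs_str (c t)) (nth 0 (js t) k) (nth 0 (a t) k) >])
    (iota 0 (size (js t))))).
  move=> t; symmetry; apply/asboolP/andP => [[sz tp]|[/eqP sz /allP tp]].
    split; first exact/eqP.
    by apply/allP => k; rewrite mem_iota => /andP[_ kj]; exact/asboolP/tp.
  by split=> // k kj; apply/asboolP/tp; rewrite mem_iota.
by comp; apply: (comp_sort_in (c := fun p => c p.1)); comp.
Qed.

Ltac comp_str :=
  match goal with
  | |- computable (fun t => asbool (sort_in _ _ _)) => apply comp_sort_in
  | |- computable (fun t => asbool (rel_in _ _ _)) => apply comp_rel_in
  | |- computable (fun t => asbool (has_type _ _ _)) => apply comp_has_type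
  | |- computable (fun t => below (sorts _) _) => apply comp_below_sorts
  | |- computable (fun t => below (rels _) _) => apply comp_below_rels
  end.
Ltac comp_hint ::= first [comp_arith | comp_seq | comp_str].

(** * Quantifier-free formulas in postfix notation *)

(** A token (tag, r) with tag < 3 stands for an atomic formula and the others for
    connectives, with the tags of [code_formula]; r is the second component of
    the code of an equality or of a relation symbol applied to variables. *)
Definition token : Type := (nat * nat)%type.

Section Postfix.
Context {V : Type} (atom : token -> V) (neg : V -> V) (bin : nat -> V -> V -> V).

(** Where the stack is too short the notation is malformed, and the stack is
    emptied. *)
Definition push (st : seq V) (k : token) : seq V :=
  if k.1 < 3 then atom k :: st
  else if st is v :: st' then
    if k.1 == 3 then neg v :: st'
    else if st' is u :: st'' then bin k.1 u v :: st'' else [::]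
  else [::].

Definition postfix (w : seq token) : seq V := foldl push [::] w.

End Postfix.

Lemma comp_postfix T V (cT : Coded T) (cV : Coded V) (atom : T -> token -> V)
    (neg : T -> V -> V) (bin : T -> nat -> V -> V -> V) (w : T -> seq token) :
    computable (fun p : T * token => atom p.1 p.2) ->
    computable (fun p : T * V => neg p.1 p.2) ->
    computable (fun p : T * (nat * (V * V)) => bin p.1 p.2.1 p.2.2.1 p.2.2.2) ->
    computable w ->
  computable (fun t => postfix (atom t) (neg t) (bin t) (w t)).
Proof.
move=> catom cneg cbin cw.
apply: (comp_foldl (g := fun t => push (atom t) (neg t) (bin t))); comp.
rewrite /push; comp.
apply: (comp_case_seq (s := fun p : T * (seq V * token) => p.2.1) (z := fun=> [::])
  (g := fun p v st' => if p.2.2.1 == 3 then neg p.1 v :: st'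
    else if st' is u :: st'' then bin p.1 p.2.2.1 u v :: st'' else [::])); comp.
apply: (comp_case_seq (s := fun p : T * (seq V * token) * (V * seq V) => p.2.2)
  (z := fun=> [::])
  (g := fun p u st'' => bin p.1.1 p.1.2.2.1 u p.2.1 :: st'')); comp.
by apply: (comp_app cbin (f := fun p : T * (seq V * token) * (V * seq V) *
  (V * seq V) => (p.1.1.1, (p.1.1.2.2.1, (p.2.1, p.1.2.1))))); comp.
Qed.

(** Evaluation commutes with homomorphisms: a function defined by recursion on
    formulas can be evaluated on the notation, without building the formula. *)
Lemma postfix_map V W (h : V -> W) atom neg bin atom' neg' bin' w :
    (forall k, k.1 < 3 -> h (atom k) = atom' k) ->
    (forall v, h (neg v) = neg' (h v)) ->
    (forall n u v, h (bin n u v) = bin' n (h u) (h v)) ->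
  map h (postfix atom neg bin w) = postfix atom' neg' bin' w.
Proof.
move=> hatom hneg hbin; rewrite /postfix -[in RHS]/(map h [::]).
elim: w [::] => //= k w IH st; rewrite IH; congr foldl.
rewrite /push; case: ltnP => [lt3|_]; first by rewrite /= hatom.
case: st => [|v st] //=; case: eqP => _; first by rewrite /= hneg.
by case: st => [|u st] //=; rewrite hbin.
Qed.

Lemma enc_seq_surj T (cT : Coded T) :
  (forall n, exists x : T, enc x = n) -> forall n, exists s : seq T, enc s = n.
Proof.
move=> surj; elim/ltn_ind => -[_|n IH]; first by exists [::].
have [x xE] := surj (cunpair n).1.
have [|s sE] := IH (cunpair n).2.
  by rewrite ltnS -[leqRHS]cunpairK; exact: leq_cpairr.
by exists (x :: s); rewrite -[in RHS](cunpairK n) -xE -sE.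
Qed.

Lemma code_varsE xs : code_vars xs = enc xs.
Proof. by elim: xs => //= x xs; rewrite /code_vars /= => ->. Qed.

Lemma enc_var_surj n : exists x : var, enc x = n.
Proof. by exists (cunpair n); exact: cunpairK. Qed.

Definition dec_vars (n : nat) : seq var :=
  projT1 (cid (enc_seq_surj enc_var_surj n)).

Lemma dec_varsK n : enc (dec_vars n) = n.
Proof. by rewrite /dec_vars; case: cid. Qed.

Lemma enc_vars_inj : injective (enc : seq var -> nat).
Proof. by move=> xs ys; rewrite -!code_varsE; exact: code_vars_inj. Qed.

Lemma enc_varsK xs : dec_vars (enc xs) = xs.
Proof. by apply: enc_vars_inj; rewrite dec_varsK. Qed.

(** As coding is bijective on lists of variables, decoding is the identity on
    codes. *)
Lemma comp_dec_vars T (cT : Coded T) (n : T -> nat) :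
  computable n -> computable (fun t => dec_vars (n t)).
Proof. by move=> [p np]; exists p => t; rewrite dec_varsK; exact: np. Qed.

Ltac comp_var :=
  match goal with
  | |- computable (fun t => dec_vars _) => apply comp_dec_vars
  | |- computable (fun t => index _ _) => apply (comp_index code_var_inj)
  | |- computable (fun t => in_mem _ (mem _)) => apply (comp_mem code_var_inj)
  | |- computable (fun t => uniq _) => apply (comp_uniq code_var_inj)
  end.
Ltac comp_hint ::= first [comp_arith | comp_seq | comp_str | comp_var].

Definition formula_atom (k : token) : formula :=
  let '(tag, r) := k in
  if tag == 0 then FBot
  else if tag == 1 then FEq (cunpair (cunpair r).1) (cunpair (cunpair r).2)
  else FRel (cunpair r).1 (dec_vars (cunpair r).2).

Definition formula_bin (tag : nat) (f g : formula) : formula :=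
  if tag == 4 then FAnd f g else if tag == 5 then FOr f g else FImp f g.

Definition parse : seq token -> seq formula :=
  postfix formula_atom FNot formula_bin.

Lemma parse_qfree w : all qfree (parse w).
Proof.
rewrite /parse /postfix; have : all qfree [::] by [].
elim: w [::] => //= k w IH st qst; apply: IH; rewrite /push.
case: ltnP => [_|_].
  by rewrite /= qst andbT; case: k => [[|[|[|?]]] r].
case: st qst => [|g st] //= /andP[qg]; case: eqP => _; first by rewrite /= qg.
case: st => [|f st] //= /andP[qf qst]; rewrite /formula_bin.
by case: eqP => _; [|case: eqP => _]; rewrite /= qf qg qst.
Qed.

(** The postfix notation of a subformula is read on top of its siblings, hence the
    induction over arbitrary stacks. *)
Lemma parse_surj f : qfree f -> exists w, parse w = [:: f].
Proof.
pose built g := exists w, forall st,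
  foldl (push formula_atom FNot formula_bin) st w = g :: st.
have built_bin n g h : 3 < n -> built g -> built h -> built (formula_bin n g h).
  move=> n3 [u uE] [v vE]; exists (u ++ v ++ [:: (n, 0)]) => st.
  by rewrite !foldl_cat uE vE /= /push /= ltnNge ltnW //= gtn_eqF.
suff qbuilt : qfree f -> built f by move=> /qbuilt[w wE]; exists w; exact: wE.
elim: f => //= [_|x y _|i xs _|f IH /IH[w wE]|f IHf g IHg|f IHf g IHg|f IHf g IHg].
- by exists [:: (0, 0)].
- exists [:: (1, cpair (enc x) (enc y))] => st.
  by rewrite /= /push /= !cpairK /enc /coded_pair ?cpairK /=; case: x; case: y.
- exists [:: (2, cpair i (enc xs))] => st.
  by rewrite /= /push /= !cpairK /= enc_varsK.
- by exists (w ++ [:: (3, 0)]) => st; rewrite foldl_cat wE.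
- by move=> /andP[/IHf bf /IHg bg]; exact: (built_bin 4).
- by move=> /andP[/IHf bf /IHg bg]; exact: (built_bin 5).
- by move=> /andP[/IHf bf /IHg bg]; exact: (built_bin 6).
Qed.

(** By [postfix_map], the values of a function h defined by recursion on formulas
    are computed on the notation itself. *)
Lemma comp_parse_map T V (cT : Coded T) (cV : Coded V) (h : T -> formula -> V)
    (neg : T -> V -> V) (bin : T -> nat -> V -> V -> V) (w : T -> seq token) :
    (forall t f, h t (FNot f) = neg t (h t f)) ->
    (forall t n f g, h t (formula_bin n f g) = bin t n (h t f) (h t g)) ->
    computable (fun p : T * token => h p.1 (formula_atom p.2)) ->
    computable (fun p : T * V => neg p.1 p.2) ->
    computable (fun p : T * (nat * (V * V)) => bin p.1 p.2.1 p.2.2.1 p.2.2.2) ->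
    computable w ->
  computable (fun t => map (h t) (parse (w t))).
Proof.
move=> hneg hbin catom cneg cbin cw.
apply: (comp_ext (f := fun t =>
  postfix (fun k => h t (formula_atom k)) (neg t) (bin t) (w t))) => [t|].
  by rewrite /parse; symmetry; exact: postfix_map.
exact: (comp_postfix (atom := fun t k => h t (formula_atom k))).
Qed.

Section FormulaFunctions.
Context {T : Type} {cT : Coded T} (w : T -> seq token).
Hypothesis cw : computable w.

Lemma comp_parse_code : computable (fun t => map code_formula (parse (w t))).
Proof.
apply: (comp_parse_map (h := fun=> code_formula) (neg := fun=> cpair 3)
  (bin := fun _ n u v =>
    cpair (if n == 4 then 4 else if n == 5 then 5 else 6) (cpair u v))) => //.
- by move=> _ n f g; rewrite /formula_bin; case: ifP => // _; case: ifP.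
- apply: (comp_ext (f := fun p : T * token => if p.2.1 == 0 then cpair 0 0
    else if p.2.1 == 1 then cpair 1 p.2.2 else cpair 2 p.2.2)); last by comp.
  move=> [t [[|[|n]] r]] //=; first by rewrite /code_var !cunpairK.
  by rewrite code_varsE dec_varsK cunpairK.
- by comp.
- by comp.
Qed.

Lemma comp_parse_free_vars : computable (fun t => map free_vars (parse (w t))).
Proof.
apply: (comp_parse_map (h := fun=> free_vars) (neg := fun=> id)
  (bin := fun _ _ => cat)) => //.
- by move=> _ n f g; rewrite /formula_bin; case: ifP => // _; case: ifP.
- apply: (comp_ext (f := fun p : T * token => if p.2.1 == 0 then [::]
    else if p.2.1 == 1 then [:: cunpair (cunpair p.2.2).1; cunpair (cunpair p.2.2).2]
    else dec_vars (cunpair p.2.2).2)).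
    by move=> [t [[|[|n]] r]].
  by comp.
- by comp.
- by comp.
Qed.

Lemma comp_parse_wf (c : T -> CompStr) : computable c ->
  computable (fun t => map (wf (cs_lang (c t))) (parse (w t))).
Proof.
move=> cc; apply: (comp_parse_map (h := fun t => wf (cs_lang (c t)))
  (neg := fun=> id) (bin := fun _ _ => andb)) => //.
- by move=> t n f g; rewrite /formula_bin; case: ifP => // _; case: ifP.
- apply: (comp_ext (f := fun p : T * token =>
    let r := p.2.2 in
    let x := cunpair (cunpair r).1 in let y := cunpair (cunpair r).2 in
    let i := (cunpair r).1 in
    if p.2.1 == 0 then true
    else if p.2.1 == 1 then below (sorts (cs_lang (c p.1))) x.1 && (x.1 == y.1)
    else below (rels (cs_lang (c p.1))) i && (var_type (dec_vars (cunpair r).2) ==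
      if below (rels (cs_lang (c p.1))) i
      then rel_type (cs_lang (c p.1)) i else [::]))).
    by move=> [t [tag r]] /=; case: tag => [|[|n]] //=; case: below.
  rewrite /var_type; cbv zeta; comp.
  apply: comp_eq; [exact: code_seq_inj | comp | ].
  by apply: (comp_rel_type (c := fun p => c p.1)); comp.
- by comp.
- by comp.
Qed.

Lemma comp_parse_sat (c : T -> CompStr) (zs : T -> seq var) (ab : T -> seq nat) :
    computable c -> computable zs -> computable ab ->
  computable (fun t =>
    map (fun f => `[< sat (cs_str (c t)) (assign (zs t) (ab t)) f >]) (parse (w t))).
Proof.
move=> cc czs cab.
apply: (comp_parse_map (h := fun t f =>
    `[< sat (cs_str (c t)) (assign (zs t) (ab t)) f >]) (neg := fun=> negb)
  (bin := fun _ n a b =>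
    if n == 4 then a && b else if n == 5 then a || b else a ==> b)).
- by move=> t f; rewrite /= asbool_neg.
- move=> t n f g; rewrite /formula_bin.
  by case: ifP => _; [|case: ifP => _];
    rewrite /= (asbool_and, asbool_or, asbool_imply).
- apply: (comp_ext (f := fun p : T * token => let r := p.2.2 in
    let v x := nth 0 (ab p.1) (index x (zs p.1)) in
    if p.2.1 == 0 then false
    else if p.2.1 == 1 then v (cunpair (cunpair r).1) == v (cunpair (cunpair r).2)
    else `[< rel_in (cs_str (c p.1)) (cunpair r).1
               (map v (dec_vars (cunpair r).2)) >])).
    move=> [t [[|[|n]] r]] //=; first by rewrite asboolF.
    by apply/eqP/asboolP.
  by cbv zeta; comp.
- by comp.
- by comp.
- by comp.
Qed.

End FormulaFunctions.

(** * The Sigma^0_2 description *)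

Lemma enc_seq_inj : injective (enc : seq nat -> nat).
Proof. exact: code_seq_inj. Qed.

(** Coding is injective, so finitely many lists lie below each bound. *)
Lemma finite_set_bounded (S : set (seq nat)) :
  finite_set S <-> exists N, forall b, S b -> enc b <= N.
Proof.
split=> [/finite_seqP[s ->]|[N SN]].
  by exists (\max_(b <- s) enc b) => b bs; exact: leq_bigmax_seq.
apply: (@sub_finite_set _ _ (enc @^-1` `I_N.+1)); first by move=> b /SN.
by apply: finite_preimage => // b b' _ _; exact: enc_seq_inj.
Qed.

(** An instance with the formula replaced by its code.  Every number is the code
    of exactly one such datum. *)
Definition instance_data : Type := ((nat * (seq var * seq var)) * seq nat)%type.

Lemma enc_pair T U {cT : Coded T} {cU : Coded U} (p : T * U) :
  enc p = cpair (enc p.1) (enc p.2).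
Proof. by []. Qed.

Lemma code_instanceE f xs ys a :
  code_instance (PFormula f xs ys, a) = enc ((code_formula f, (xs, ys)), a).
Proof. by rewrite /code_instance /code_pformula /= !code_varsE. Qed.

(** The matrix of the Sigma^0_2 description.  In n = (N, w), N bounds the codes
    of the solutions and w is a postfix notation of the formula; the first
    condition forces [parse n.2] to be the list of that single formula. *)
Definition witnesses (c : CompStr) (x : instance_data) (n : nat * seq token)
    (b : seq nat) : bool :=
  let xs := x.1.2.1 in let ys := x.1.2.2 in let a := x.2 in
  let zs := xs ++ ys in let fs := parse n.2 in
  [&& map code_formula fs == [:: x.1.1],
      all id (map (wf (cs_lang c)) fs),
      all (fun vs => all (fun v => v \in zs) vs && all (fun v => v \in vs) zs)
        (map free_vars fs),
      uniq zs,
      `[< has_type (sort_in (cs_str c)) a (var_type xs) >] &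
      `[< has_type (sort_in (cs_str c)) b (var_type ys) >] &&
      all id (map (fun f => `[< sat (cs_str c) (assign zs (a ++ b)) f >]) fs)
        ==> (enc b <= n.1)].

Ltac comp_parse :=
  match goal with
  | |- computable (fun t => map _ (parse _)) =>
      first [ apply comp_parse_code | apply comp_parse_free_vars
            | apply comp_parse_wf | apply comp_parse_sat ]
  end.
Ltac comp_hint ::= first [comp_arith | comp_parse | comp_seq | comp_str | comp_var].

Lemma comp_witnesses : computable
  (fun p : CompStr * (instance_data * ((nat * seq token) * seq nat)) =>
    witnesses p.1 p.2.1 p.2.2.1 p.2.2.2).
Proof.
rewrite /witnesses /var_type; cbv zeta; comp.
by apply: comp_eq; [exact: code_seq_inj | comp | comp].
Qed.

Lemma eq_mem_allP (zs vs : seq var) :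
  reflect (vs =i zs) (all (fun v => v \in zs) vs && all (fun v => v \in vs) zs).
Proof.
apply: (iffP andP) => [[/allP vz /allP zv] v|vz].
  by apply/idP/idP => [/vz|/zv].
by split; apply/allP => v; rewrite vz.
Qed.

Lemma ACL0_witnesses (c : CompStr) (x : instance_data) :
  (code_instance @` ACL0 c) (enc x) <-> exists n, forall b, witnesses c x n b.
Proof.
split.
  move=> [[[f xs ys] a] [wfp qf ta /finite_set_bounded[N NP]]].
  rewrite code_instanceE => /cpair_inj[/cpair_inj[fE /cpair_inj[xsE ysE]] aE].
  have [w wE] := parse_surj qf.
  case: x fE xsE ysE aE => [[e [xs' ys']] a'] /= fE.
  move=> /enc_vars_inj <- /enc_vars_inj <- /enc_seq_inj <-.
  have {}fE : code_formula f = e := fE.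
  case: wfp => /= wff uz fvz.
  exists (N, w) => b; rewrite /witnesses /= wE /= fE eqxx wff uz !andbT /=.
  apply/and3P; split; [exact/eq_mem_allP | exact/asboolP |].
  by apply/implyP => /andP[/asboolP tb /asboolP sb]; apply: NP.
case: x => [[e [xs ys]] a] [[N w]]; rewrite /witnesses /= => chk.
(* any b gives the conditions that do not depend on b *)
have /and5P[/eqP fE wff fvz uz /andP[/asboolP ta _]] := chk [::].
case: (parse w) (parse_qfree w) fE wff fvz chk => [|f [|g fs]] //=.
rewrite !andbT => qf [<-] wff /eq_mem_allP fvz chk.
exists (PFormula f xs ys, a); last by rewrite code_instanceE.
split=> //=; apply/finite_set_bounded; exists N => b [tb sb].
have /and5P[_ _ _ _ /andP[_ /implyP]] := chk b; apply.
by rewrite andbT; apply/andP; split; apply/asboolP.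
Qed.

(** The s-m-n theorem: the index of the program p with its first argument fixed
    to n is computable from n. *)
Lemma comp_specialize (p : prog) :
  computable (fun n : nat => code_prog (PComp p (PPair (pconst n) pid))).
Proof.
apply: (comp_ext (f := fun n => cpair 5 (cpair (code_prog p) (cpair 4 (cpair
    (iteri n (fun _ r => cpair 5 (cpair (code_prog PSucc) r)) (code_prog PZero))
    (code_prog pid)))))) => [n|].
  rewrite [RHS]/=; congr (cpair 5 (cpair _ (cpair 4 (cpair _ _)))).
  by elim: n => //= n ->.
comp.
by apply: (comp_iteri (g := fun _ _ r => cpair 5 (cpair (code_prog PSucc) r))); comp.
Qed.

Lemma instance_data_surj n : exists x : instance_data, enc x = n.
Proof.
have [xs xsE] := enc_seq_surj enc_var_surj (cunpair (cunpair (cunpair n).1).2).1.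
have [ys ysE] := enc_seq_surj enc_var_surj (cunpair (cunpair (cunpair n).1).2).2.
have [a aE] : exists a : seq nat, enc a = (cunpair n).2.
  by apply: enc_seq_surj => k; exists k.
exists (((cunpair (cunpair n).1).1, (xs, ys)), a).
by rewrite !enc_pair xsE ysE aE /= /enc /coded_nat !cunpairK.
Qed.

Theorem proposition3p1 :
  exists f : nat, forall c : CompStr,
    exists2 e : nat, run f (cs_code c) e
                   & Sigma02_index e (code_instance @` ACL0 c).
Proof.
have [p pP] := comp_witnesses.
have [s sP] := comp_specialize p.
exists (code_prog s) => c.
exists (code_prog (PComp p (PPair (pconst c) pid))).
  by exists s => //; exact: sP.
(* decoders for the three numerical arguments of the matrix *)
have /choice[X XK] := instance_data_surj.
have /choice[N NK] (n : nat) : exists y : nat * seq token, enc y = n.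
  have [w wE] := enc_seq_surj enc_var_surj (cunpair n).2.
  by exists ((cunpair n).1, w); rewrite /enc /coded_pair /= wE cunpairK.
have /choice[B BK] : forall n, exists b : seq nat, enc b = n.
  by apply: enc_seq_surj => k; exists k.
have NE (n : nat * seq token) : N (enc n) = n.
  have : enc (N (enc n)) = enc n by exact: NK.
  case: (N (enc n)) => k' w'; case: n => k w.
  by move=> /cpair_inj[/= kE /enc_vars_inj ->]; congr (_, w); exact: kE.
exists (fun x n m => witnesses c (X x) (N n) (B m)); split=> [k|x]; last first.
  rewrite -{1}(XK x) ACL0_witnesses; split=> [[n nP]|[n nP]].
    by exists (enc n) => m; rewrite NE.
  by exists (N n) => b; rewrite -(enc_seq_inj (BK (enc b))).
set b := witnesses c (X (cunpair k).1) (N (cunpair (cunpair k).2).1)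
  (B (cunpair (cunpair k).2).2).
have runb : run (code_prog (PComp p (PPair (pconst c) pid))) k b.
  exists (PComp p (PPair (pconst c) pid)) => //.
  exists (cpair c k).
    by exists (cs_code c), k; split; [exact: eval_pconst | exact: eval_pid |].
  have := pP (c, (X (cunpair k).1, (N (cunpair (cunpair k).2).1,
    B (cunpair (cunpair k).2).2))).
  rewrite (enc_pair (_, (_, _))) (enc_pair (X _, _)) (enc_pair (N _, _)) /=.
  by rewrite XK NK BK !cunpairK.
have memb : [set k | exists x n m, k = cpair x (cpair n m) /\
    witnesses c (X x) (N n) (B m)] k <-> b.
  split=> [[x [n [m [kE chk]]]]|bT]; first by rewrite /b kE !cpairK /=.
  exists (cunpair k).1, (cunpair (cunpair k).2).1, (cunpair (cunpair k).2).2.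
  by rewrite !cunpairK.
case: b runb memb => runb memb; [left|right]; split=> //.
  exact/memb.
by move/memb.
Qed.
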